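(* If the exponents $p_1,p_2,p_3,r$ satisfy $$1<p_1,p_2,p_3<\infty,\qquad r^{-1}=\sum_{1\le i\le3}p_i^{-1},\qquad r^{-1}+2p_1^{-1}>4,$$ then there is no finite constant $C$ such that the inequality $$\bigg\|\mathrm{p.v.}\int_{\mathbb R}f_1(x-t)f_2(x-t^2)f_3(x-t^3)\,\frac{dt}{t}\bigg\|_{L^r_x(\mathbb R)}\le C\prod_{1\le i\le3}\|f_i\|_{L^{p_i}(\mathbb R)}$$ holds for all functions $f_i\in L^{p_i}(\mathbb R)$, $1\le i\le3$.
   Context: For $0<r<1$, $\|f\|_{L^r}=(\int|f|^r)^{1/r}$. The principal value is the limit as $\epsilon\to0^+$ of the integral over $|t|>\epsilon$. *)

(* Defs.v *)
From HB Require Import structures.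
From mathcomp Require Import all_boot all_order all_algebra.
From mathcomp Require Import all_classical all_reals all_analysis.

Set Implicit Arguments.
Unset Strict Implicit.
Unset Printing Implicit Defensive.

Import Order.TTheory GRing.Theory Num.Theory.
Import numFieldNormedType.Exports.

Local Open Scope classical_set_scope.
Local Open Scope ring_scope.

Section TrilinearOperator.
Context {R : realType}.
Local Notation mu := (@lebesgue_measure R).

Definition integrand (f1 f2 f3 : R -> R) (x t : R) : R :=
  f1 (x - t) * f2 (x - t ^+ 2) * f3 (x - t ^+ 3) / t.

Definition truncated (f1 f2 f3 : R -> R) (x eps : R) : R :=
  \int[mu]_(t in [set t : R | eps < `|t|]) integrand f1 f2 f3 x t.

(* Integrability is required separately: the integral in [truncated] is a total
   function, with a default value when the integrand is not integrable. *)
Definition pv_exists (f1 f2 f3 : R -> R) (x : R) : Prop :=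
  (forall eps : R, 0 < eps ->
     mu.-integrable [set t : R | eps < `|t|]
       (EFin \o integrand f1 f2 f3 x)) /\
  cvg (truncated f1 f2 f3 x eps @[eps --> 0^'+]).

(* Meaningful only at the points [x] where [pv_exists f1 f2 f3 x] holds. *)
Definition pv (f1 f2 f3 : R -> R) (x : R) : R :=
  lim (truncated f1 f2 f3 x eps @[eps --> 0^'+]).

End TrilinearOperator.

(* Main.v *)
Require Import Defs.
From HB Require Import structures.
From mathcomp Require Import all_boot all_order all_algebra.
From mathcomp Require Import all_classical all_reals all_analysis.
From mathcomp Require Import measurable_realfun zify ring lra.

(** The inequality fails on indicators of sparse sets depending on a large integer
    [M]. Put [a = x - t], so that the other two arguments are [t - t ^ 2 + a] and
    [t - t ^ 3 + a]. Near a time [t0], write [P = 2 t0 - 1], [W = 3 t0 ^ 2 - 1] and,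
    with [h] of order [M ^ -3] and [0 <= m, n < M], take
      [t = t0 + h (n / P - m / W)],  [a = (n - m) h],  [x = t + a].
    To first order [x - t] depends only on [n - m], [x - t ^ 2] only on [m] and
    [x - t ^ 3] only on [n], while [x] depends on both [m] and [n]. So [M ^ 2] points
    [x] are served by [O(M)] values of each argument, and second order terms are of
    size [M ^ -4]: everything may be thickened to intervals of that length
    ([hit1], [hit2], [hit3]).

    The values of [x - t] do not involve [t0]; the same set for [f1] therefore serves
    [4 M ^ 2] block times [t0] in [[2, 3]], spaced by [M ^ -2] / 4. In total the set
    for [f1] has measure [O(M ^ -3)], those for [f2] and [f3] have measure
    [O(M ^ -1)], and at each of the points constructed, in a window of length
    comparable to [M ^ -4], the operator is at least a multiple of [M ^ -4].

    These windows have total measure bounded below ([measure_target]). Indeed, up to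
    a bounded factor, the points of a block are the [h (n - m g(t0))] for a slope [g],
    and they are separated at scale [M ^ -4] unless some [e g(t0)] with [0 < e < M] is
    within [O(1 / M)] of an integer. As [g] is strictly increasing, such a resonance
    happens in at most half of the blocks ([card_nonresonant]).

    Hence the left-hand side is at least a multiple of [M ^ -4] ([Lnorm_pv_ge]) and
    the product of norms is at most a multiple of [M ^ - (3 / p1 + 1 / p2 + 1 / p3)]
    ([Lnorm_sources_le]); the hypothesis says that this last exponent exceeds [4] in
    absolute value. The singularity of the kernel never matters, since the supports
    force [1 <= t] ([sources_away]), so the principal values exist everywhere
    ([pv_exists_indic]). *)

Set Implicit Arguments.
Unset Strict Implicit.
Unset Printing Implicit Defensive.

Import Order.TTheory GRing.Theory Num.Theory.
Import numFieldNormedType.Exports.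

Local Open Scope ring_scope.

(** * A counting lemma *)

Lemma card_le_diameter (n L : nat) (S : {set 'I_n}) :
  (forall i j, i \in S -> j \in S -> (i <= j + L)%N) -> (#|S| <= L.+1)%N.
Proof.
move=> SL; have [->|[i0 i0S]] := set_0Vmem S; first by rewrite cards0.
case: (arg_minnP (fun i : 'I_n => i : nat) i0S) => j jS jmin.
pose f (i : 'I_n) : 'I_L.+1 := inord (i - j).
rewrite -[L.+1]card_ord -(@card_in_imset _ _ f) ?max_card//.
move=> i k iS kS /(congr1 val); rewrite /= !inordK.
- move: (jmin i iS) (jmin k kS) => ji jk h; apply: val_inj => /=; lia.
- by have := SL k j kS jS; lia.
- by have := SL i j iS jS; lia.
Qed.

(** * The slope of the lattice of a block *)

Section Slope.
Context {R : realFieldType}.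
Implicit Types t u : R.

(** The opposites of the derivatives of [t - t ^ 2] and [t - t ^ 3]. *)
Definition speed2 t : R := 2 * t - 1.
Definition speed3 t : R := 3 * t ^+ 2 - 1.
(** To first order the points [x] of the block at time [t] are proportional to
    [n - m * slope t], for integers [m] and [n]. *)
Definition slope t : R :=
  (1 + (speed3 t)^-1) / (1 + (speed2 t)^-1).

Lemma speed2_bounds t : 2 <= t <= 3 -> 3 <= speed2 t <= 5.
Proof. by rewrite /speed2; lra. Qed.

Lemma speed3_bounds t : 2 <= t <= 3 -> 11 <= speed3 t <= 26.
Proof. by rewrite /speed3 => ?; nra. Qed.

Lemma slopeE t : 2 <= t <= 3 -> slope t = 1 - (3 * t - 2) / (6 * t ^+ 2 - 2).
Proof.
move=> t23; have := speed2_bounds t23; have := speed3_bounds t23.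
rewrite /slope /speed2 /speed3 => h3 h2; field.
by do ![apply/andP; split]; apply: lt0r_neq0; nra.
Qed.

Lemma slope_bounds t : 2 <= t <= 3 -> 3 / 5 <= slope t <= 9 / 10.
Proof.
move=> t23; rewrite slopeE//.
have D : 0 < 6 * t ^+ 2 - 2 by nra.
suff : 1 / 10 <= (3 * t - 2) / (6 * t ^+ 2 - 2) <= 2 / 5 by lra.
by rewrite ler_pdivlMr// ler_pdivrMr//; nra.
Qed.

(** Transversality: distinct times have quantitatively distinct slopes, so a
    given rational slope can only be approached in few blocks. *)
Lemma slope_expand t u : 2 <= t <= 3 -> 2 <= u <= 3 -> t <= u ->
  (u - t) / 100 <= slope u - slope t.
Proof.
move=> t23 u23 tu; rewrite !slopeE//.
have Dt : 0 < 6 * t ^+ 2 - 2 <= 52 by nra.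
have Du : 0 < 6 * u ^+ 2 - 2 <= 52 by nra.
have -> : 1 - (3 * u - 2) / (6 * u ^+ 2 - 2) - (1 - (3 * t - 2) / (6 * t ^+ 2 - 2)) =
    (u - t) * (18 * t * u + 6 - 12 * (t + u)) / ((6 * t ^+ 2 - 2) * (6 * u ^+ 2 - 2)).
  by field; apply/andP; split; apply: lt0r_neq0; lra.
have D : 0 < (6 * t ^+ 2 - 2) * (6 * u ^+ 2 - 2) by apply: mulr_gt0; lra.
rewrite ler_pdivlMr//.
have D1 : (6 * t ^+ 2 - 2) * (6 * u ^+ 2 - 2) <= 52 * 52 by apply: ler_pM; lra.
have N : 30 <= 18 * t * u + 6 - 12 * (t + u) by nra.
rewrite -!mulrA; apply: ler_wpM2l; first lra.
by lra.
Qed.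

End Slope.

(** * Most blocks have a slope far from fractions of small denominator *)

Section Blocks.
Context {R : realFieldType}.
Variable M : nat.
Hypothesis M0 : (0 < M)%N.

Definition block_time (b : nat) : R := 2 + b%:R / (4 * M%:R ^+ 2).

Let Mgt0 : 0 < M%:R :> R. Proof. by rewrite ltr0n. Qed.

Lemma block_time_bounds b : (b < 4 * M ^ 2)%N -> 2 <= block_time b <= 3.
Proof.
move=> bM; rewrite /block_time.
have D : 0 < 4 * M%:R ^+ 2 :> R by rewrite mulr_gt0// exprn_gt0.
suff : 0 <= (b%:R : R) / (4 * M%:R ^+ 2) <= 1 by lra.
rewrite divr_ge0 ?ler0n ?(ltW D)//= ler_pdivrMr// mul1r.
by rewrite -natrX -natrM ler_nat ltnW.
Qed.

(** The threshold [1 / (800 M)] is the width of a window in units of the lattice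
    step; a resonance makes two windows of the same block overlap. *)
Definition resonant (e d b : nat) : bool :=
  `|d%:R - e%:R * slope (block_time b)| <= (800 * M%:R)^-1.

(** By [slope_expand], [e * |c - b| / (400 M ^ 2)] is at most the sum of the two
    distances to [d], that is [2 / (800 M)]. *)
Lemma resonant_close (e d b c : nat) : (0 < e)%N ->
  (b < 4 * M ^ 2)%N -> (c < 4 * M ^ 2)%N ->
  resonant e d b -> resonant e d c -> (c <= b + M %/ e)%N.
Proof.
move=> e0 bM cM rb rc; have [cb|bc] := leqP c b; first exact: leq_trans cb (leq_addr _ _).
have lebc : block_time b <= block_time c.
  rewrite /block_time lerD2l ler_pM2r ?ler_nat ?(ltnW bc)//.
  by rewrite invr_gt0 mulr_gt0// exprn_gt0.
have := slope_expand (block_time_bounds bM) (block_time_bounds cM) lebc.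
have -> : block_time c - block_time b = (c - b)%:R / (4 * M%:R ^+ 2).
  by rewrite natrB ?(ltnW bc)// /block_time; field; rewrite gt_eqF.
move=> expand.
have e0' : 0 < e%:R :> R by rewrite ltr0n.
have inv : (800 * M%:R)^-1 = M%:R / (800 * M%:R ^+ 2) :> R.
  by field; rewrite gt_eqF.
have := ler_wpM2l (ltW e0') expand.
move: rb rc; rewrite /resonant !ler_norml inv => /andP[b1 b2] /andP[c1 c2] h.
have {}h : e%:R * ((c - b)%:R / (4 * M%:R ^+ 2) / 100)
    <= 2 * (M%:R / (800 * M%:R ^+ 2)) :> R.
  by move: h b1 b2 c1 c2; rewrite mulrBr; lra.
have {}h : e%:R * (c - b)%:R <= M%:R :> R.
  have D : 0 <= 400 * M%:R ^+ 2 :> R by rewrite !(mulr_ge0, exprn_ge0, ler0n).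
  have := ler_wpM2l D h.
  rewrite [X in _ <= X -> _](_ : _ = M%:R); last by field; rewrite gt_eqF.
  by rewrite [X in X <= _ -> _](_ : _ = e%:R * (c - b)%:R)//; field; rewrite gt_eqF.
rewrite -leq_subLR leq_divRL//.
by rewrite mulnC -(ler_nat R) natrM.
Qed.

(** As the slope lies in [[3/5, 9/10]], only [0 < d < e] can be resonant; keeping
    these constraints here is what makes the union bound summable. *)
Definition resonances (e d : nat) : {set 'I_(4 * M ^ 2)} :=
  [set b : 'I__ | [&& 0 < e, d < e & resonant e d b]%N].

Lemma card_resonances (e d : nat) :
  (#|resonances e d| <= ((0 < e) && (d < e)) * (M %/ e).+1)%N.
Proof.
case: (boolP ((0 < e) && (d < e))%N) => [/andP[e0 de]|ned].
  rewrite mul1n; apply: card_le_diameter => i j.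
  rewrite !inE e0 de /= => ri rj.
  exact: resonant_close rj ri.
rewrite mul0n leqn0 cards_eq0; apply/eqP/setP => b; rewrite !inE.
by move: ned; rewrite andbA => /negbTE ->.
Qed.

Definition nonresonant : {set 'I_(4 * M ^ 2)} :=
  [set b : 'I__ | [forall e : 'I_M, forall d : 'I_M, b \notin resonances e d]].

(** For a denominator [e < M] there are at most [e] numerators, each resonant in
    at most [M / e + 1] blocks; this gives at most [2 M] bad blocks for each [e],
    hence at most half of the [4 M ^ 2] blocks in total. *)
Lemma card_nonresonant : (2 * M ^ 2 <= #|nonresonant|)%N.
Proof.
have -> : nonresonant = ~: \bigcup_(p : 'I_M * 'I_M) resonances p.1 p.2.
  apply/setP => b; rewrite !inE; apply/forallP/negP => [h|h e].
    by case/bigcupP => -[e d] _; apply/negP; move/forallP: (h e); apply.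
  by apply/forallP => d; apply/negP => bed; apply: h; apply/bigcupP; exists (e, d).
have : (#|\bigcup_(p : 'I_M * 'I_M) resonances p.1 p.2| <= 2 * M ^ 2)%N.
  apply: (@leq_trans (\sum_(p : 'I_M * 'I_M) #|resonances p.1 p.2|)).
    elim/big_rec2: _ => [|p B n _ IH]; first by rewrite cards0.
    by rewrite (leq_trans (leq_card_setU _ _))// leq_add2l.
  rewrite -(pair_bigA _ (fun e d : 'I_M => #|resonances e d|))/=.
  apply: (@leq_trans (\sum_(e < M) 2 * M)); last first.
    by rewrite sum_nat_const card_ord; nia.
  apply: leq_sum => e _.
  apply: (@leq_trans (\sum_(d < M) (d < e) * (M %/ e).+1)).
    apply: leq_sum => d _; apply: leq_trans (card_resonances _ _) _.
    by rewrite leq_mul2r; case: (0 < e)%N => //=; rewrite orbT.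
  rewrite -big_distrl /= -(big_mkord xpredT (fun d => (d < e) : nat)).
  rewrite (big_cat_nat (n := e)) ?(ltnW (ltn_ord e))//=.
  rewrite big_nat (eq_bigr (fun=> 1%N)); last by move=> i /andP[_ ->].
  rewrite -big_nat sum_nat_const_nat subn0 muln1.
  rewrite big_nat big1 ?addn0; last by move=> i /andP[ei _]; rewrite ltnNge ei.
  by have := leq_divM M e; have := ltn_ord e; nia.
have := cardsC (\bigcup_(p : 'I_M * 'I_M) resonances p.1 p.2); rewrite card_ord.
by lia.
Qed.

End Blocks.

(** * The lattice configuration *)

Section Configuration.
Context {R : realFieldType}.
Variable M : nat.
Hypothesis M1 : (1 < M)%N.
Local Notation base := (@block_time R M).

(** A block has [M] steps in each direction, hence size [M * step], of order
    [M ^ -2]; the second order error is then of order [M ^ -4 = width]. *)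
Definition step : R := (16 * M%:R ^+ 3)^-1.
Definition width : R := (M%:R ^+ 4)^-1.
(** The numerical factors make [2 * window = step / (800 M)], the separation of
    the points of a nonresonant block. *)
Definition window : R := (32 * 800 * M%:R ^+ 4)^-1.

(** This time solves, to first order in the increment [s] from the block time, the
    two conditions that [x - t ^ 2] be independent of [n] and [x - t ^ 3] be
    independent of [m] when [x - t = (n - m) * step]. *)
Definition focus_time (b m n : nat) : R :=
  base b + step * (n%:R / speed2 (base b) - m%:R / speed3 (base b)).
Definition focus (b m n : nat) : R := focus_time b m n + (n%:R - m%:R) * step.

(** The values of [x - t], [x - t ^ 2] and [x - t ^ 3] at [x = focus b m n] and
    [t = focus_time b m n], up to second order in the size of the block. The first
    one does not depend on the block; it is [d = n + M - m] that indexes it, so as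
    to stay in the natural numbers. *)
Definition center1 (d : nat) : R := (d%:R - M%:R) * step.
Definition center2 (b m : nat) : R :=
  base b - base b ^+ 2 - step * m%:R * (1 - speed2 (base b) / speed3 (base b)).
Definition center3 (b n : nat) : R :=
  base b - base b ^+ 3 - step * n%:R * (speed3 (base b) / speed2 (base b) - 1).

Let q : R := (M%:R ^+ 2)^-1.
Let Mgt0 : 0 < M%:R :> R. Proof. by rewrite ltr0n ltnW. Qed.
Let q_bounds : 0 < q <= 1 / 4.
Proof.
rewrite /q invr_gt0 exprn_gt0//= mul1r lef_pV2 ?posrE ?exprn_gt0//.
by rewrite -natrX ler_nat; nia.
Qed.
Let stepM : step * M%:R = q / 16.
Proof. by rewrite /step /q; field; rewrite gt_eqF. Qed.
Let widthE : width = q ^+ 2.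
Proof. by rewrite /width /q; field; rewrite gt_eqF. Qed.
Let windowE : window = q ^+ 2 / 32 / 800.
Proof. by rewrite /window /q; field; rewrite gt_eqF. Qed.

Lemma step_gt0 : 0 < step.
Proof. by rewrite /step invr_gt0 !mulr_gt0// ?exprn_gt0. Qed.

Lemma width_gt0 : 0 < width.
Proof. by rewrite invr_gt0 exprn_gt0. Qed.

Lemma window_gt0 : 0 < window.
Proof. by rewrite /window !(invr_gt0, mulr_gt0, exprn_gt0, ltr0n)// ltnW. Qed.

Let stepn (n : nat) : (n < M)%N -> 0 <= step * n%:R <= q / 16.
Proof.
move=> nM; rewrite mulr_ge0 ?ler0n ?(ltW step_gt0)//= -stepM.
by rewrite ler_pM2l ?step_gt0// ler_nat ltnW.
Qed.

Let div_bounds (a b c k : R) : 0 < c -> c <= b -> 0 <= a -> a <= k ->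
  0 <= a / b <= k / c.
Proof.
move=> c0 cb a0 ak; have b0 := lt_le_trans c0 cb.
rewrite divr_ge0 ?(ltW b0)//=; apply: ler_pM => //; first by rewrite invr_ge0 ltW.
by rewrite lef_pV2.
Qed.

Lemma focus_time_base b m n : (b < 4 * M ^ 2)%N -> (m < M)%N -> (n < M)%N ->
  `|focus_time b m n - base b| <= q / 48.
Proof.
move=> bM mM nM; have t23 : 2 <= base b <= 3 := block_time_bounds (ltnW M1) bM.
have /andP[P3 _] := speed2_bounds t23; have /andP[W11 _] := speed3_bounds t23.
have /andP[n0 n1] := stepn nM; have /andP[m0 m1] := stepn mM.
have -> : focus_time b m n - base b =
    step * n%:R / speed2 (base b) - step * m%:R / speed3 (base b).
  by rewrite /focus_time mulrBr !mulrA; ring.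
have /andP[] := div_bounds (ltr0n R 3) P3 n0 n1.
have /andP[] := div_bounds (ltr0n R 11) W11 m0 m1.
by rewrite ler_norml; move: q_bounds; lra.
Qed.

(** In this section [s] is the increment from the block time, and [u], [v] are the
    deviations within the window. All errors are explicit: the terms linear in [s]
    cancel exactly, what remains is of order [s ^ 2 + |u| + |v|]. *)
Section Hit.
Variables (b m n : nat) (x t : R).
Hypotheses (bM : (b < 4 * M ^ 2)%N) (mM : (m < M)%N) (nM : (n < M)%N).
Hypotheses (hx : `|x - focus b m n| <= window) (ht : `|t - focus_time b m n| <= window).

Let s := focus_time b m n - base b.
Let u := x - focus b m n.
Let v := t - focus_time b m n.
Let hs : `|s| <= q / 48. Proof. exact: focus_time_base. Qed.
Let hu : `|u| <= q ^+ 2 / 32 / 800. Proof. by rewrite -windowE. Qed.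
Let hv : `|v| <= q ^+ 2 / 32 / 800. Proof. by rewrite -windowE. Qed.
Let t23 : 2 <= base b <= 3. Proof. exact: (block_time_bounds (ltnW M1) bM). Qed.
Let speeds : (speed2 (base b) != 0) && (speed3 (base b) != 0).
Proof.
have := speed2_bounds t23; have := speed3_bounds t23.
by move=> *; apply/andP; split; apply: lt0r_neq0; lra.
Qed.

Let hT : `|base b + s| <= 4.
Proof. by move: t23 hs q_bounds; rewrite !ler_norml; lra. Qed.
Let hs2 : `|s ^+ 2| <= q ^+ 2 / 48 / 48.
Proof.
rewrite normrX; apply: (@le_trans _ _ ((q / 48) ^+ 2)); last by rewrite expr2; lra.
by rewrite ler_pXn2r ?nnegrE//; move: q_bounds; lra.
Qed.
Let hs3 : `|s ^+ 3| <= q ^+ 2 / 48 / 48.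
Proof.
rewrite exprS normrM; apply: le_trans hs2; rewrite ler_piMl//.
by move: hs q_bounds; lra.
Qed.
Let hv1 : `|v| <= 1.
Proof. by move: hv q_bounds; rewrite expr2 => *; nra. Qed.
Let hv2 : `|v ^+ 2| <= q ^+ 2 / 32 / 800.
Proof. by rewrite normrX; apply: le_trans hv; rewrite expr2 ler_piMl. Qed.
Let hv3 : `|v ^+ 3| <= q ^+ 2 / 32 / 800.
Proof. by rewrite exprS normrM; apply: le_trans hv2; rewrite ler_piMl. Qed.

Lemma focus_time_le4 : t <= 4.
Proof.
have -> : t = base b + s + v by rewrite /s /v; ring.
move: t23 hs hv q_bounds; rewrite !ler_norml expr2 => *; nra.
Qed.

Lemma hit1 : `|x - t - center1 (n + M - m)| <= width.
Proof.
have -> : x - t - center1 (n + M - m) = u - v.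
  rewrite /center1 natrB ?natrD; last by rewrite (leq_trans (ltnW mM))// leq_addl.
  by rewrite /u /v /focus; ring.
rewrite widthE; move: hu hv; rewrite !ler_norml.
by have := sqr_ge0 q; lra.
Qed.

Lemma hit2 : `|x - t ^+ 2 - center2 b m| <= width.
Proof.
have -> : x - t ^+ 2 - center2 b m =
    - s ^+ 2 + u - 2 * (base b + s) * v - v ^+ 2.
  rewrite /center2 /u /v /focus /s /focus_time; move: speeds.
  by rewrite /speed2 /speed3 => /andP[??]; field; apply/andP.
have h : `|(base b + s) * v| <= 4 * (q ^+ 2 / 32 / 800) by rewrite normrM ler_pM.
rewrite widthE; move: hs2 hu hv2 h (sqr_ge0 q); rewrite !ler_norml; lra.
Qed.

Lemma hit3 : `|x - t ^+ 3 - center3 b n| <= width.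
Proof.
have -> : x - t ^+ 3 - center3 b n =
    - (3 * base b * s ^+ 2) - s ^+ 3 + u
    - 3 * (base b + s) ^+ 2 * v - 3 * (base b + s) * v ^+ 2 - v ^+ 3.
  rewrite /center3 /u /v /focus /s /focus_time; move: speeds.
  by rewrite /speed2 /speed3 => /andP[??]; field; apply/andP.
have h1 : `|base b * s ^+ 2| <= 3 * (q ^+ 2 / 48 / 48).
  by rewrite normrM ler_pM// ger0_norm; move: t23; lra.
have h2 : `|(base b + s) ^+ 2 * v| <= 4 ^+ 2 * (q ^+ 2 / 32 / 800).
  by rewrite normrM ler_pM// normrX ler_pXn2r ?nnegrE//; lra.
have h3 : `|(base b + s) * v ^+ 2| <= 4 * (q ^+ 2 / 32 / 800).
  by rewrite normrM ler_pM.
rewrite widthE; move: hu hs3 hv3 h1 h2 h3 (sqr_ge0 q); rewrite !ler_norml; lra.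
Qed.

End Hit.

Lemma center1_support d y : (d < 2 * M)%N ->
  `|y - center1 d| <= width -> `|y| <= 1 / 8.
Proof.
move=> dM; rewrite /center1 widthE => hy.
have : `|(d%:R - M%:R) * step| <= q / 16.
  rewrite normrM [`|step|]ger0_norm ?(ltW step_gt0)// -stepM mulrC.
  rewrite ler_pM2l ?step_gt0// ler_norml.
  have : (d%:R : R) <= 2 * M%:R by rewrite -natrM ler_nat ltnW.
  by have := ler0n R d; lra.
by move: hy q_bounds; rewrite !ler_norml expr2 => *; nra.
Qed.

(** Since [t - t ^ 3 <= -6] for [2 <= t]. *)
Lemma center3_support b n y : (b < 4 * M ^ 2)%N ->
  `|y - center3 b n| <= width -> y <= - 5 - 1 / 8.
Proof.
move=> bM hy.
have t23 : 2 <= base b <= 3 := block_time_bounds (ltnW M1) bM.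
have P := speed2_bounds t23; have W := speed3_bounds t23.
have h1 : 0 <= step * n%:R * (speed3 (base b) / speed2 (base b) - 1).
  apply: mulr_ge0; first by rewrite mulr_ge0 ?ler0n ?(ltW step_gt0).
  by rewrite subr_ge0 ler_pdivlMr; lra.
have h2 : base b - base b ^+ 3 <= - 6 by rewrite !exprS expr0; nra.
move: hy q_bounds; rewrite /center3 widthE ler_norml expr2 => *; nra.
Qed.

(** The points of a block spread over less than the spacing [q / 4] of consecutive
    block times, with [q = M ^ -2]; this keeps the blocks apart. *)
Lemma focus_base b m n : (b < 4 * M ^ 2)%N -> (m < M)%N -> (n < M)%N ->
  - (q / 14) <= focus b m n - base b <= q / 11.
Proof.
move=> bM mM nM; have t23 : 2 <= base b <= 3 := block_time_bounds (ltnW M1) bM.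
have /andP[P3 _] := speed2_bounds t23; have /andP[W11 _] := speed3_bounds t23.
have /andP[n0 n1] := stepn nM; have /andP[m0 m1] := stepn mM.
have -> : focus b m n - base b = step * n%:R + step * n%:R / speed2 (base b)
    - (step * m%:R + step * m%:R / speed3 (base b)).
  by rewrite /focus /focus_time; ring.
have /andP[] := div_bounds (ltr0n R 3) P3 n0 n1.
have /andP[] := div_bounds (ltr0n R 11) W11 m0 m1.
by move: q_bounds; lra.
Qed.

Lemma focus_separated_blocks b m n b' m' n' : (b < b' < 4 * M ^ 2)%N ->
  (m < M)%N -> (n < M)%N -> (m' < M)%N -> (n' < M)%N ->
  2 * window < focus b' m' n' - focus b m n.
Proof.
move=> /andP[bb' b'M] mM nM m'M n'M.
have := focus_base (ltn_trans bb' b'M) mM nM; have := focus_base b'M m'M n'M.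
have : base b + q / 4 <= base b'.
  have -> : base b + q / 4 = 2 + b.+1%:R / (4 * M%:R ^+ 2).
    by rewrite /block_time /q -natr1; field; rewrite gt_eqF.
  by rewrite /block_time lerD2l ler_pM2r ?ler_nat// invr_gt0 mulr_gt0// exprn_gt0.
by rewrite windowE; move: q_bounds; rewrite expr2 => *; nra.
Qed.

(** With [e = m - m'] and [d = n - n'], a violation would force [0 < d < e], and
    so be a resonance; for [m = m'] the distance is at least [1]. *)
Lemma nonresonant_slope (b : 'I_(4 * M ^ 2)) (m m' n n' : nat) :
  b \in nonresonant (R := R) M -> (m' <= m)%N ->
  (m < M)%N -> (n < M)%N -> (n' < M)%N -> (m, n) != (m', n') ->
  (800 * M%:R)^-1 < `|n%:R - n'%:R - (m%:R - m'%:R) * slope (base b)|.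
Proof.
move=> bsep lem mM nM n'M neq.
have g : 3 / 5 <= slope (base b) <= 9 / 10.
  exact: slope_bounds (block_time_bounds (ltnW M1) (ltn_ord b)).
have small : (800 * M%:R)^-1 <= 1 / 800 :> R.
  rewrite invfM mul1r; apply: ler_piMr; first by rewrite invr_ge0 ler0n.
  by rewrite invf_le1// ler1n ltnW.
have [mm'|m'm|mm'] := ltngtP m' m; [|by rewrite leqNgt m'm in lem|].
- rewrite -(natrB _ (ltnW mm')) ltNge; apply/negP => res.
  have e1 : (1 : R) <= (m - m')%:R by rewrite ler1n subn_gt0.
  have := res; rewrite ler_norml => /andP[r1 r2].
  have lenn : (n' < n)%N by rewrite -(ltr_nat R); nra.
  have de : (n - n' < m - m')%N by rewrite -(ltr_nat R) natrB ?(ltnW lenn)//; nra.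
  have eM : (m - m' < M)%N by exact: leq_ltn_trans (leq_subr _ _) mM.
  have dM : (n - n' < M)%N by exact: ltn_trans de eM.
  move: bsep; rewrite inE => /forallP/(_ (Ordinal eM))/forallP/(_ (Ordinal dM)).
  by rewrite inE /= subn_gt0 mm' de /= /resonant natrB ?(ltnW lenn)// res.
- have nn' : n != n' by apply: contra neq => /eqP ->; rewrite mm'.
  rewrite mm' subrr mul0r subr0; apply: le_lt_trans small _.
  apply: (@lt_le_trans _ _ 1); first lra.
  have [h|h|h] := ltngtP n n'; last by rewrite h eqxx in nn'.
    by rewrite distrC -(natrB _ (ltnW h)) ger0_norm ?ler0n// ler1n subn_gt0.
  by rewrite -(natrB _ (ltnW h)) ger0_norm ?ler0n// ler1n subn_gt0.
Qed.

Lemma focus_separated (b b' : 'I_(4 * M ^ 2)) (m n m' n' : 'I_M) :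
  b \in nonresonant (R := R) M ->
  (b, m, n) != (b', m', n') ->
  2 * window < `|focus b m n - focus b' m' n'|.
Proof.
move=> bsep neq.
have [bb'|bb'|bb'] := ltngtP b b'.
- rewrite distrC; apply: lt_le_trans (ler_norm _).
  by apply: focus_separated_blocks => //; rewrite bb' ltn_ord.
- apply: lt_le_trans (ler_norm _).
  by apply: focus_separated_blocks => //; rewrite bb' ltn_ord.
have {}bb' : b = b' by exact: val_inj.
have {}neq : (m : nat, n : nat) != (m' : nat, n' : nat).
  by apply: contra neq => /eqP[/val_inj -> /val_inj ->]; rewrite bb'.
have t23 : 2 <= base b <= 3 := block_time_bounds (ltnW M1) (ltn_ord b).
have P := speed2_bounds t23; have W := speed3_bounds t23.
have Q : 1 < 1 + (speed2 (base b))^-1 by rewrite ltrDl invr_gt0; lra.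
have -> : focus b m n - focus b' m' n' = step * ((1 + (speed2 (base b))^-1) *
    (n%:R - n'%:R - (m%:R - m'%:R) * slope (base b))).
  rewrite -bb' /focus /focus_time /slope; field.
  by apply/and3P; split; apply: lt0r_neq0; lra.
have -> : 2 * window = step * (800 * M%:R)^-1.
  by rewrite /window /step; field; rewrite gt_eqF.
rewrite normrM [`|step|]gtr0_norm ?step_gt0// ltr_pM2l ?step_gt0// normrM.
have h : (800 * M%:R)^-1 < `|n%:R - n'%:R - (m%:R - m'%:R) * slope (base b)|.
  have [lem|/ltnW lem] := leqP m' m; first exact: nonresonant_slope.
  rewrite (_ : _ - _ = - (n'%:R - n%:R - (m'%:R - m%:R) * slope (base b))); last by ring.
  rewrite normrN.
  by apply: nonresonant_slope; rewrite // eq_sym.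
rewrite gtr0_norm; last by lra.
by apply: lt_le_trans h _; rewrite ler_peMl// ltW.
Qed.

End Configuration.

Local Open Scope classical_set_scope.

(** * Norms of indicators and a Chebyshev bound *)

Section Norms.
Context d (T : measurableType d) (R : realType) (mu : {measure set T -> \bar R}).
Local Open Scope ereal_scope.

(** Monotonicity without measurability: the integral of a nonnegative function is
    a supremum over the simple functions below it. It spares a proof that the
    principal value is a measurable function of [x]. *)
Lemma le_integralT (f g : T -> \bar R) :
  (forall x, 0 <= f x) -> (forall x, f x <= g x) ->
  \int[mu]_x f x <= \int[mu]_x g x.
Proof.
move=> f0 fg; have g0 x : 0 <= g x by exact: le_trans (f0 x) (fg x).
rewrite !ge0_integralTE//; apply: le_ereal_sup => _ [h hf <-].
by exists h => // x; exact: le_trans (hf x) (fg x).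
Qed.

Lemma Lnorm_indic (p : R) (E : set T) : (0 < p)%R -> measurable E ->
  'N[mu]_(p%:E)[EFin \o \1_E] = mu E `^ p^-1.
Proof.
move=> p0 mE; rewrite unlock; congr (_ `^ _).
rewrite -[in RHS](setIT E) -integral_indic//; apply: eq_integral => x _ /=.
rewrite indicE; case: (x \in E).
  by rewrite normr1 powR1.
by rewrite normr0 powR0 ?gt_eqF.
Qed.

Lemma indic_Lfun (p : R) (E : set T) : (0 < p)%R -> measurable E ->
  mu E < +oo -> (\1_E : T -> R) \in Lfun mu p%:E.
Proof.
move=> p0 mE muE; rewrite inE; apply/andP; split; rewrite inE/=.
  exact: measurable_indic.
by rewrite /finite_norm Lnorm_indic// poweR_lty.
Qed.

Lemma Lnorm_ge (r c : R) (f : T -> R) (A : set T) :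
  (0 < r)%R -> (0 <= c)%R -> measurable A -> (forall x, A x -> (c <= `|f x|)%R) ->
  c%:E * mu A `^ r^-1 <= 'N[mu]_(r%:E)[EFin \o f].
Proof.
move=> r0 c0 mA cf.
have -> : c%:E = (c%:E `^ r) `^ r^-1 :> \bar R.
  by rewrite -poweRrM mulfV ?gt_eqF// poweRe1.
rewrite unlock -poweRM ?poweR_ge0//.
apply: gt0_ler_poweR; rewrite ?invr_ge0 ?(ltW r0)// ?in_itv/= ?andbT ?leey ?andbT//.
- by rewrite mule_ge0// lee_fin powR_ge0.
- by apply: integral_ge0 => x _; rewrite lee_fin powR_ge0.
rewrite -integral_cst// integral_mkcond.
apply: le_integralT => x; rewrite patchE; case: ifPn => [|_].
- by move=> _ /=; rewrite lee_fin powR_ge0.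
- by [].
- rewrite inE => Ax /=; rewrite lee_fin; apply: ge0_ler_powR; rewrite ?nnegrE//.
    by rewrite ltW.
  exact: cf.
- by rewrite lee_fin powR_ge0.
Qed.

End Norms.

(** * Finite unions of intervals of equal length *)

Section Thickening.
Context {R : realType} (I : finType).
Local Notation mu := (@lebesgue_measure R).
Implicit Types (A : {set I}) (c : I -> R) (w : R).

Definition thickening A c w : set R :=
  \bigcup_(i in [set` A]) `[c i - w, c i + w]%classic.

Lemma thickeningP A c w y :
  thickening A c w y <-> exists2 i, i \in A & `|y - c i| <= w.
Proof.
split=> -[i iA]; rewrite /= ?in_itv/= => h; exists i => //=.
  by rewrite ler_distl.
by rewrite in_itv /= -ler_distl.
Qed.

Lemma measurable_thickening A c w : measurable (thickening A c w).
Proof. by apply: fin_bigcup_measurable => // i _; exact: measurable_itv. Qed.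

Let measure_piece c w i : 0 < w -> mu `[c i - w, c i + w]%classic = (2 * w)%:E.
Proof.
move=> w0; rewrite lebesgue_measure_itv/= lte_fin ifT; last by lra.
by rewrite -EFinB; congr (_%:E); ring.
Qed.

Lemma measure_thickening_le A c w : 0 < w ->
  (mu (thickening A c w) <= (#|A|%:R * (2 * w))%:E)%E.
Proof.
move=> w0; rewrite /thickening bigcup_pred.
suff [] : (mu (\big[setU/set0]_(i in A) `[(c i - w)%R, (c i + w)%R]%classic) <=
    (\sum_(i in A) 2 * w)%R%:E)%E /\
    measurable (\big[setU/set0]_(i in A) `[c i - w, c i + w]%classic).
  by rewrite sumr_const -[(_ * _) *+ _]mulr_natl.
elim/big_rec2: _ => [|i x B _ [IH mB]]; first by rewrite measure0.
split; last by apply: measurableU => //; exact: measurable_itv.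
apply: le_trans; first by apply: measureU2 => //; exact: measurable_itv.
by rewrite EFinD leeD// -(measure_piece c i w0).
Qed.

Lemma measure_thickening_disjoint A c w : 0 < w ->
  {in A &, forall i j, i != j -> 2 * w < `|c i - c j|} ->
  mu (thickening A c w) = (#|A|%:R * (2 * w))%:E.
Proof.
move=> w0 sep; rewrite /thickening measure_fin_bigcup//.
- rewrite (eq_fsbigr (fun=> (2 * w)%:E)); last by move=> i _; exact: measure_piece.
  have -> : [set` A] = [set` enum A] by apply/seteqP; split => i /=; rewrite mem_enum.
  by rewrite -fsbig_seq ?enum_uniq// sumEFin big_enum sumr_const -[(_ * _) *+ _]mulr_natl.
- apply/trivIsetP => i j /= iA jA ij; rewrite -subset0 => y /= [].
  rewrite !in_itv /= => /andP[h1 h2] /andP[h3 h4].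
  move: (sep _ _ iA jA ij); rewrite ltNge => /negP; apply.
  by rewrite ler_norml; lra.
Qed.

End Thickening.

(** * The operator on indicators whose supports avoid the singularity *)

Section Indicators.
Context {R : realType}.
Local Notation mu := (@lebesgue_measure R).
Variables E1 E2 E3 : set R.
Hypotheses (mE1 : measurable E1) (mE2 : measurable E2) (mE3 : measurable E3).
Hypothesis E1_bounded : forall y, E1 y -> `|y| <= 1.
Hypothesis E13_away : forall x t, E1 (x - t) -> E3 (x - t ^+ 3) -> 1 <= t.

Definition slice (x : R) : set R :=
  [set t | [/\ E1 (x - t), E2 (x - t ^+ 2) & E3 (x - t ^+ 3)]].

Lemma slice_ge1 x t : slice x t -> 1 <= t.
Proof. by case=> e1 _; exact: E13_away. Qed.

(** The kernel is written as a power because powers are known to be measurable;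
    it agrees with [1 / t] on the slice, where [1 <= t]. *)
Lemma integrand_indic x :
  integrand \1_E1 \1_E2 \1_E3 x = (fun t => t `^ (-1)) \_ (slice x).
Proof.
apply/funext => t; rewrite patchE /integrand !indicE.
case: ifPn => [|/negP nS].
  rewrite inE => St; rewrite powR_inv1 ?(le_trans ler01 (slice_ge1 St))//.
  by case: St => *; rewrite !mem_set// !mul1r.
have [e1|e1] := boolP (x - t \in E1); last by rewrite !mul0r.
have [e2|e2] := boolP (x - t ^+ 2 \in E2); last by rewrite mulr0 !mul0r.
have [e3|e3] := boolP (x - t ^+ 3 \in E3); last by rewrite mulr0 !mul0r.
by exfalso; apply: nS; rewrite inE; split; apply: set_mem.
Qed.

Let measurable_shift x n (E : set R) : measurable E ->
  measurable [set t | E (x - t ^+ n)].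
Proof.
move=> mE; rewrite -[X in measurable X]setTI.
have mf : measurable_fun [set: R] (fun t : R => x - t ^+ n).
  by apply: measurable_funB => //; exact: measurable_funX.
exact: mf.
Qed.

Lemma measurable_slice x : measurable (slice x).
Proof.
have -> : slice x = [set t | E1 (x - t ^+ 1)] `&` [set t | E2 (x - t ^+ 2)]
                    `&` [set t | E3 (x - t ^+ 3)].
  by apply/seteqP; split => t /=; rewrite /slice /= expr1; [case|case=> -[]].
by apply: measurableI; [apply: measurableI|]; exact: measurable_shift.
Qed.

Lemma integrable_integrand x :
  mu.-integrable setT (EFin \o integrand \1_E1 \1_E2 \1_E3 x).
Proof.
(* The Lebesgue measure lives on [measurableTypeR R], whose display differs from
   that of [R]. *)
have mS : measurable (slice x : set (measurableTypeR R)) := measurable_slice x.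
suff int : mu.-integrable (slice x) (EFin \o (fun t : R => t `^ (-1))).
  rewrite (_ : EFin \o _ = (EFin \o (fun t => t `^ (-1))) \_ (slice x)).
    exact: (iffLR (integrable_mkcond _ mS) int).
  by rewrite integrand_indic; apply/funext => t; rewrite /= !patchE; case: ifP.
apply: measurable_bounded_integrable => //.
- apply: (@le_lt_trans _ _ (mu `[x - 1, x + 1]%classic)).
    apply: le_measure; rewrite ?inE; [exact: measurable_slice|exact: measurable_itv|].
    move=> t [/E1_bounded + _ _]; rewrite /= in_itv /= ler_norml; lra.
  by rewrite lebesgue_measure_itv /= lte_fin ifT ?ltry//; lra.
- by apply: measurable_funTS; exact: measurable_powR.
- exists 1; split; first exact: num_real.
  move=> y y1 t /= /slice_ge1 t1; apply: le_trans (ltW y1).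
  rewrite powR_inv1; last lra.
  by rewrite ger0_norm ?invr_ge0 ?invf_le1; lra.
Qed.

Let measurable_outside (eps : R) : measurable [set t : R | eps < `|t|].
Proof.
rewrite (_ : [set t | _] = ~` `[- eps, eps]%classic).
  by apply: measurableC; exact: measurable_itv.
apply/seteqP; split => t /=; rewrite in_itv /= -ler_norml.
  by move=> h; apply/negP; rewrite -ltNge.
by move/negP; rewrite -ltNge.
Qed.

(** The slice lies in [1 <= t], so truncating below [1] removes nothing: the
    truncated integrals are eventually constant. *)
Lemma truncated_indic x eps : eps < 1 ->
  truncated \1_E1 \1_E2 \1_E3 x eps =
  \int[mu]_t integrand \1_E1 \1_E2 \1_E3 x t.
Proof.
move=> eps1; rewrite /truncated Rintegral_mkcond; congr Rintegral.
apply/funext => t; rewrite patchE integrand_indic patchE.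
case: ifPn => // /negP out; case: ifPn => // inS; exfalso; apply: out.
have t1 := slice_ge1 (set_mem inS).
by rewrite inE /= ger0_norm; lra.
Qed.

Lemma pv_exists_indic x : pv_exists \1_E1 \1_E2 \1_E3 x.
Proof.
split=> [eps eps0|].
  apply: integrableS (integrable_integrand x) => //.
  exact: measurable_outside.
apply: is_cvg_near_cst; near=> eps; apply: truncated_indic.
by near: eps; exact: nbhs_right_lt.
Unshelve. all: by end_near. Qed.

Lemma pv_indic x : pv \1_E1 \1_E2 \1_E3 x =
  \int[mu]_t integrand \1_E1 \1_E2 \1_E3 x t.
Proof.
apply: lim_near_cst => //; near=> eps; apply: truncated_indic.
by near: eps; exact: nbhs_right_lt.
Unshelve. all: by end_near. Qed.

Lemma pv_indic_ge x t0 rho : 0 < rho ->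
  (forall t, `|t - t0| <= rho -> slice x t /\ t <= 4) ->
  rho / 2 <= pv \1_E1 \1_E2 \1_E3 x.
Proof.
move=> rho0 hits; rewrite pv_indic.
pose J := `[t0 - rho, t0 + rho]%classic.
have -> : rho / 2 = fine ((4^-1)%:E * mu J).
  rewrite lebesgue_measure_itv/= lte_fin ifT; last by lra.
  by rewrite -EFinB -EFinM /=; lra.
apply: fine_le.
- rewrite fin_numM// lebesgue_measure_itv/= lte_fin ifT; last by lra.
  by rewrite -EFinB.
- exact: integrable_fin_num (integrable_integrand x).
rewrite -integral_cst; last exact: measurable_itv.
rewrite integral_mkcond; apply: le_integralT => t; rewrite patchE.
  by case: ifP => _ //; rewrite lee_fin; lra.
rewrite integrand_indic patchE; case: ifPn => [|_]; last first.
  by case: ifP; rewrite lee_fin// powR_ge0.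
rewrite inE /J /= in_itv /= -ler_distl => /hits[St t4].
rewrite mem_set// lee_fin; have t1 := slice_ge1 St.
by rewrite powR_inv1 ?lef_pV2 ?posrE; lra.
Qed.

End Indicators.

(** * The counterexample at scale M *)

Section Counterexample.
Context {R : realType}.
Local Notation mu := (@lebesgue_measure R).
Variable M : nat.
Hypothesis M1 : (1 < M)%N.

Definition source1 : set R :=
  thickening [set: 'I_(2 * M)]%SET (fun d => center1 M d) (width M).
Definition source2 : set R :=
  thickening [set: 'I_(4 * M ^ 2) * 'I_M]%SET (fun i => center2 M i.1 i.2) (width M).
Definition source3 : set R :=
  thickening [set: 'I_(4 * M ^ 2) * 'I_M]%SET (fun i => center3 M i.1 i.2) (width M).
Definition target : set R :=
  thickening [set i : 'I_(4 * M ^ 2) * 'I_M * 'I_M | i.1.1 \in nonresonant (R := R) M]%SET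
    (fun i => focus M i.1.1 i.1.2 i.2) (window M).

Let Mgt0 : 0 < M%:R :> R. Proof. by rewrite ltr0n ltnW. Qed.

Lemma measure_source1 : (mu source1 <= (8 * (M%:R ^+ 3)^-1)%:E)%E.
Proof.
apply: le_trans (measure_thickening_le _ _ (width_gt0 M1)) _.
rewrite cardsT card_ord lee_fin /width natrM.
have -> : 2 * M%:R * (2 * (M%:R ^+ 4)^-1) = 4 * (M%:R ^+ 3)^-1 :> R.
  by field; rewrite gt_eqF.
by rewrite ler_pM2r ?invr_gt0 ?exprn_gt0//; lra.
Qed.

Let measure_grid (c : 'I_(4 * M ^ 2) * 'I_M -> R) :
  (mu (thickening [set: 'I_(4 * M ^ 2) * 'I_M]%SET c (width M)) <= (8 * M%:R^-1)%:E)%E.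
Proof.
apply: le_trans (measure_thickening_le _ _ (width_gt0 M1)) _.
rewrite cardsT card_prod !card_ord lee_fin /width !natrM ?natrX.
by rewrite le_eqVlt; apply/orP; left; apply/eqP; field; rewrite gt_eqF.
Qed.

Lemma measure_source2 : (mu source2 <= (8 * M%:R^-1)%:E)%E.
Proof. exact: measure_grid. Qed.

Lemma measure_source3 : (mu source3 <= (8 * M%:R^-1)%:E)%E.
Proof. exact: measure_grid. Qed.

(** At least [2 M ^ 2] nonresonant blocks, each with [M ^ 2] disjoint windows of
    length [2 / (25600 M ^ 4)]: the measure is bounded below independently of [M]. *)
Lemma measure_target : ((80^-1 / 80)%:E <= mu target)%E.
Proof.
rewrite measure_thickening_disjoint ?window_gt0//; last first.
  move=> [[b m] n] [[b' m'] n']; rewrite inE /= => bsep _ neq.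
  exact: focus_separated.
have -> : [set i : 'I_(4 * M ^ 2) * 'I_M * 'I_M | i.1.1 \in nonresonant (R := R) M]%SET
    = finset.setX (finset.setX (nonresonant (R := R) M) [set: 'I_M]%SET) [set: 'I_M]%SET.
  by apply/finset.setP => -[[b m] n]; rewrite !inE /= !andbT.
rewrite !cardsX !cardsT !card_ord lee_fin.
have : (2 * M ^ 2 * M * M <= #|nonresonant (R := R) M| * M * M)%N.
  by rewrite !leq_mul2r card_nonresonant ?orbT// ltnW.
rewrite -(ler_nat R) => h.
have {}h := ler_wpM2r (ltW (window_gt0 (R := R) M1)) h.
rewrite mulrCA; apply: le_trans (ler_wpM2l (ler0n R 2) h).
rewrite !natrM ?natrX /window le_eqVlt; apply/orP; left; apply/eqP.
by field; rewrite gt_eqF.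
Qed.

Lemma source1_bounded y : source1 y -> `|y| <= 1 / 8.
Proof. by case/thickeningP => d _; exact: center1_support. Qed.

Lemma source3_bounded y : source3 y -> y <= - 5 - 1 / 8.
Proof. by case/thickeningP => -[b n] _; exact: center3_support. Qed.

Lemma sources_away x t : source1 (x - t) -> source3 (x - t ^+ 3) -> 1 <= t.
Proof.
move=> /source1_bounded + /source3_bounded; rewrite ler_norml => /andP[h1 h2] h3.
have {h1 h2 h3} : 5 <= t ^+ 3 - t by lra.
(* For [t < 1] the cubic [t ^ 3 - t] is below [1]: the identity splits off
   the tangent at [- 3 / 5], near the local maximum [- 1 / sqrt 3]. *)
have -> : t ^+ 3 - t = (t - 6 / 5) * (t + 3 / 5) ^+ 2 + 2 / 25 * t + 54 / 125.
  by field.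
move=> h; rewrite leNgt; apply/negP => t1.
have : (t - 6 / 5) * (t + 3 / 5) ^+ 2 <= 0.
  by apply: mulr_le0_ge0; [lra|exact: sqr_ge0].
lra.
Qed.

Lemma target_hits x : target x ->
  exists t0, forall t, `|t - t0| <= window M ->
    slice source1 source2 source3 x t /\ t <= 4.
Proof.
case/thickeningP => -[[b m] n] /= _ hx; exists (focus_time M b m n) => t ht.
have t4 := focus_time_le4 M1 (ltn_ord b) (ltn_ord m) (ltn_ord n) ht.
split=> //; split; apply/thickeningP.
- have dM : (n + M - m < 2 * M)%N by have := ltn_ord n; lia.
  by exists (Ordinal dM); rewrite ?inE//=; exact: hit1 hx ht.
- by exists (b, m); rewrite ?inE//=; exact: hit2 hx ht.
- by exists (b, n); rewrite ?inE//=; exact: hit3 hx ht.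
Qed.

Let measurable_source1 : measurable source1.
Proof. exact: measurable_thickening. Qed.
Let measurable_source2 : measurable source2.
Proof. exact: measurable_thickening. Qed.
Let measurable_source3 : measurable source3.
Proof. exact: measurable_thickening. Qed.
Let source1_le1 y : source1 y -> `|y| <= 1.
Proof. by move/source1_bounded; lra. Qed.

Lemma pv_exists_sources x : pv_exists \1_source1 \1_source2 \1_source3 x.
Proof. by apply: pv_exists_indic => //; exact: sources_away. Qed.

Lemma pv_target x : target x ->
  window M / 2 <= pv \1_source1 \1_source2 \1_source3 x.
Proof.
move=> /target_hits[t0 hits].
by apply: pv_indic_ge hits; rewrite ?window_gt0//; exact: sources_away.
Qed.

Lemma Lnorm_pv_ge (r : R) : 0 < r ->
  ((64^-1 / 800 * (80^-1 / 80) `^ r^-1 * (M%:R ^+ 4)^-1)%:E <=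
    'N[mu]_(r%:E)[EFin \o pv \1_source1 \1_source2 \1_source3])%E.
Proof.
move=> r0.
have w0 : 0 <= window M / 2 :> R by rewrite divr_ge0 ?(ltW (window_gt0 M1)).
have mX : measurable (target : set (measurableTypeR R)).
  exact: measurable_thickening.
have := @Lnorm_ge _ _ _ mu _ _ (pv \1_source1 \1_source2 \1_source3) _ r0 w0 mX.
move=> lower; apply: (le_trans _ (lower _)); last first.
  by move=> x /pv_target h; apply: le_trans h (ler_norm _).
have -> : 64^-1 / 800 * (80^-1 / 80) `^ r^-1 * (M%:R ^+ 4)^-1 =
    window M / 2 * (80^-1 / 80) `^ r^-1 :> R.
  by rewrite /window; field; rewrite gt_eqF.
rewrite EFinM; apply: lee_wpmul2l; first by rewrite lee_fin.
rewrite -poweR_EFin; apply: gt0_ler_poweR.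
- by rewrite invr_ge0 ltW.
- by rewrite in_itv /= leey andbT lee_fin; lra.
- by rewrite in_itv /= leey andbT.
- exact: measure_target.
Qed.

Lemma Lnorm_sources_le (p1 p2 p3 : R) : 0 < p1 -> 0 < p2 -> 0 < p3 ->
  ('N[mu]_(p1%:E)[EFin \o \1_source1] * 'N[mu]_(p2%:E)[EFin \o \1_source2]
    * 'N[mu]_(p3%:E)[EFin \o \1_source3] <=
   (8 `^ (p1^-1 + p2^-1 + p3^-1)
    * M%:R `^ (- (3 * p1^-1 + p2^-1 + p3^-1)))%:E)%E.
Proof.
move=> p10 p20 p30; rewrite !Lnorm_indic//.
have factor k (p : R) (E : set R) : 0 < p ->
    (mu E <= (8 * (M%:R ^+ k)^-1)%:E)%E ->
    (mu E `^ p^-1 <= (8 `^ p^-1 * M%:R `^ (- (k%:R * p^-1)))%:E)%E.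
  move=> p0 hE; have Mk : 0 <= M%:R `^ (- k%:R) :> R by exact: powR_ge0.
  have h8 : 0 <= 8 * M%:R `^ (- k%:R) :> R by rewrite mulr_ge0.
  rewrite -mulNr powRrM -powRM// -poweR_EFin; apply: gt0_ler_poweR.
  - by rewrite invr_ge0 ltW.
  - by rewrite in_itv /= leey andbT.
  - by rewrite in_itv /= leey andbT lee_fin.
  - by rewrite powRN powR_mulrn// ltW.
apply: le_trans.
  apply: lee_pmul; [|exact: poweR_ge0| |exact: (factor 1%N _ _ p30 measure_source3)].
    by rewrite mule_ge0// poweR_ge0.
  apply: lee_pmul; [exact: poweR_ge0|exact: poweR_ge0| |].
    exact: (factor 3%N _ _ p10 measure_source1).
  exact: (factor 1%N _ _ p20 measure_source2).
have M0 : M%:R != 0 :> R by rewrite gt_eqF.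
have E0 : 8 != 0 :> R by rewrite pnatr_eq0.
rewrite -!EFinM lee_fin !mul1r !opprD !powRD ?M0 ?E0 ?implybT//.
by rewrite le_eqVlt; apply/orP; left; apply/eqP; ring.
Qed.

End Counterexample.

Unset Implicit Arguments.

Theorem propositionB1 (R : realType) (p1 p2 p3 r : R)
  (hp1 : 1 < p1) (hp2 : 1 < p2) (hp3 : 1 < p3)
  (hr : r^-1 = p1^-1 + p2^-1 + p3^-1)
  (hr1 : 4 < r^-1 + 2 * p1^-1) :
  ~ exists C : R, forall f1 f2 f3 : R -> R,
      f1 \in Lfun (@lebesgue_measure R) p1%:E ->
      f2 \in Lfun (@lebesgue_measure R) p2%:E ->
      f3 \in Lfun (@lebesgue_measure R) p3%:E ->
      {ae @lebesgue_measure R, forall x, pv_exists f1 f2 f3 x} ->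
      ('N[@lebesgue_measure R]_(r%:E)[EFin \o pv f1 f2 f3] <=
       C%:E * ('N[@lebesgue_measure R]_(p1%:E)[EFin \o f1] *
               'N[@lebesgue_measure R]_(p2%:E)[EFin \o f2] *
               'N[@lebesgue_measure R]_(p3%:E)[EFin \o f3]))%E.
Proof.
move=> [C bound].
have p10 : 0 < p1 by lra.
have p20 : 0 < p2 by lra.
have p30 : 0 < p3 by lra.
have r0 : 0 < r by rewrite -invr_gt0 hr !addr_gt0// invr_gt0.
(* [e] is the excess in the hypothesis on the exponents; the scale [M] loses a
   factor [M ^ e] in the inequality. *)
pose e := 3 * p1^-1 + p2^-1 + p3^-1 - 4.
have e0 : 0 < e by rewrite /e; lra.
pose k : R := 64^-1 / 800 * (80^-1 / 80) `^ r^-1.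
have k0 : 0 < k by rewrite !(mulr_gt0, powR_gt0, invr_gt0, ltr0n).
pose B := `|C| * 8 `^ r^-1 / k.
have B0 : 0 <= B by rewrite /B !mulr_ge0 ?powR_ge0// invr_ge0 ltW.
suff grow M : (1 < M)%N -> M%:R `^ e <= B.
  pose M := (Num.trunc (B `^ e^-1)).+2.
  have /grow : (1 < M)%N by [].
  apply/negP; rewrite -ltNge.
  have {1}-> : B = (B `^ e^-1) `^ e by rewrite -powRrM mulVf ?gt_eqF// powRr1.
  apply: gt0_ltr_powR; rewrite ?nnegrE ?powR_ge0//.
  have := truncnS_gt (B `^ e^-1).
  by move/lt_le_trans; apply; rewrite ler_nat.
move=> M1; have M0 : 0 < M%:R :> R by rewrite ltr0n ltnW.
have ae : {ae @lebesgue_measure R, forall x,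
    pv_exists \1_(source1 M) \1_(source2 M) \1_(source3 M) x}.
  by apply: aeW => x; exact: pv_exists_sources.
have := bound \1_(source1 (R := R) M) \1_(source2 M) \1_(source3 M).
have fin E (mE : measurable E) b p : 0 < p -> (@lebesgue_measure R E <= b%:E)%E ->
    (\1_E : R -> R) \in Lfun (@lebesgue_measure R) p%:E.
  by move=> p0 hE; apply: indic_Lfun => //; apply: le_lt_trans hE (ltry _).
move=> /(_ (fin _ (measurable_thickening _ _ _) _ _ p10 (measure_source1 M1))).
move=> /(_ (fin _ (measurable_thickening _ _ _) _ _ p20 (measure_source2 M1))).
move=> /(_ (fin _ (measurable_thickening _ _ _) _ _ p30 (measure_source3 M1))).
move=> /(_ ae); set N := (N in (C%:E * N)%E) => bnd.
have N0 : (0 <= N)%E by rewrite !mule_ge0// Lnorm_ge0.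
have absC : (C%:E * N <= `|C|%:E * N)%E by rewrite lee_wpmul2r// lee_fin ler_norm.
have upper := lee_wpmul2l (_ : 0 <= `|C|%:E)%E (Lnorm_sources_le M1 p10 p20 p30).
have := le_trans (Lnorm_pv_ge M1 r0) (le_trans bnd (le_trans absC (upper _))).
rewrite lee_fin normr_ge0 => /(_ isT).
rewrite -EFinM lee_fin -hr -/k.
have -> : - (3 * p1^-1 + p2^-1 + p3^-1) = - e + - 4%:R by rewrite /e; ring.
have -> : M%:R `^ (- e + - 4%:R) = (M%:R `^ e)^-1 * (M%:R ^+ 4)^-1.
  rewrite powRD; last by rewrite (gt_eqF M0) implybT.
  by rewrite !powRN powR_mulrn// ltW.
have Me : 0 < M%:R `^ e by exact: powR_gt0.
rewrite !mulrA ler_pM2r ?invr_gt0 ?exprn_gt0// ler_pdivlMr// => h.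
by rewrite /B ler_pdivlMr// mulrC.
Qed.
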